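(* Let $F$ be a filling of the Young diagram of a partition $\mu=(\mu_1\ge\mu_2\ge\cdots\ge\mu_k)$ with positive integers, and let $R_1,R_2,\ldots,R_k$ be its rows from bottom to top ($R_i$ a word of length $\mu_i$, read left to right). Let $\psi(F)$ be the filling of the same shape with rows $R_1',\ldots,R_k'$ (bottom to top) defined recursively by $R_1'=R_1$ and $R_i'=\psi_{R_{i-1}'}(R_i)$ for $i\ge2$. Then \[ \sum_{i=1}^k \operatorname{inv}(R_i)=\operatorname{inv}(\psi(F)), \] where on the left $\operatorname{inv}$ of a word is its usual number of inversions and on the right $\operatorname{inv}$ is the inversion statistic on fillings.
   Context: Words: for a word $w=w_1\cdots w_n$ over $\mathbb{Z}_+$, $\operatorname{inv}(w)=|\{(i,j): i<j,\ w_i>w_j\}|$, and $w_{[i,j]}=w_iw_{i+1}\cdots w_j$. Basement lift maps: for $i\in\mathbb{Z}_+$ and any length $n$, $B_i$ sends $w$ to the word with $(B_i(w))_j=i$ iff $w_{n+1-j}=i$, and whose subword of letters $\ne i$ equals that of $w$ (positions of the letters $i$ are reflected, other letters keep their order). For integers $0\le i<j$ put $B_{i\to j}=B_j\circ B_{j-1}\circ\cdots\circ B_{i+1}$ and $B_{j\to i}=B_{i\to j}^{-1}=B_{i+1}^{-1}\circ\cdots\circ B_j^{-1}$; $B_{i\to i}$ is the identity. Elevator map: for $m\ge n$ and a word $a=a_1\cdots a_m$, $\psi_a$ maps a word $w$ of length $n$ as follows: $w^{(1)}=B_{0\to a_1}(w)$, and for $2\le i\le n$, $w^{(i)}=w^{(i-1)}_{[1,i-1]}\cdot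 B_{a_{i-1}\to a_i}\big(w^{(i-1)}_{[i,n]}\big)$ (apply $B_{a_{i-1}\to a_i}$ to the last $n-i+1$ letters, keeping the first $i-1$ letters); set $\psi_a(w)=w^{(n)}$. Fillings: a filling of shape $\mu$ assigns a positive integer to each cell of the Young diagram, drawn with row 1 (of length $\mu_1$) at the bottom and rows left-justified. Inversion statistic on fillings: an inversion triple is a triple of cells $x,y,z$ where $x$ and $y$ lie in the same row with $x$ strictly left of $y$, and $z$ is the cell directly below $x$, such that (writing the entries as $x,y,z$) $x=z\ne y$, or $x>y>z$, or $y>z>x$, or $z>x>y$. An inversion pair is a pair of cells $x,y$ in the bottom row with $x$ strictly left of $y$ and $x>y$. Then $\operatorname{inv}(F)$ is the number of inversion triples plus the number of inversion pairs. *)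

(* Defs.v *)
From mathcomp Require Import all_boot.

Set Implicit Arguments.
Unset Strict Implicit.
Unset Printing Implicit Defensive.

(* A word is a [seq nat] and a filling a [seq (seq nat)] listing its rows from
   bottom to top.  Letters are positive; this is required by [is_filling] and
   used by no definition.  Indices are 0-based throughout. *)

Definition word_inv (w : seq nat) : nat :=
  #|[set p : 'I_(size w) * 'I_(size w) |
      (p.1 < p.2) && (nth 0 w p.1 > nth 0 w p.2)]|.

(* [fill_word i m s] has the letter i at the true positions of m, and the
   letters of s, in order, at the false ones. *)
Fixpoint fill_word (i : nat) (m : bitseq) (s : seq nat) : seq nat :=
  match m with
  | [::] => [::]
  | true :: m' => i :: fill_word i m' s
  | false :: m' => head 0 s :: fill_word i m' (behead s)
  end.

(* The map B_i; [basement_lift_eqE] and [basement_lift_neqE] below are its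
   two defining properties. *)
Definition basement_lift (i : nat) (w : seq nat) : seq nat :=
  fill_word i [seq x == i | x <- rev w] [seq x <- w | x != i].

(* The map B_{i -> j}: for i <= j it is B_j o ... o B_{i+1}, and otherwise
   B_{j+1}^{-1} o ... o B_i^{-1}.  Each B_l is an involution
   ([basement_liftK]), so B_l also stands for B_l^{-1}; [lift_pathK] shows
   that B_{i -> j} and B_{j -> i} are inverse to each other. *)
Definition lift_path (i j : nat) (w : seq nat) : seq nat :=
  if i <= j then foldl (fun u l => basement_lift l u) w (iota i.+1 (j - i))
  else foldr (fun l u => basement_lift l u) w (iota j.+1 (i - j)).

(* [elevator_step a w i] is w^(i), with the conventions w^(0) = w and
   a_0 = 0, so that w^(1) = B_{0 -> a_1}(w) is an instance of the general
   step.  Since [a] is 0-based, a_i is [nth 0 (0 :: a) i]. *)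
Fixpoint elevator_step (a w : seq nat) (i : nat) : seq nat :=
  match i with
  | 0 => w
  | i'.+1 =>
      let u := elevator_step a w i' in
      take i' u ++
      lift_path (nth 0 (0 :: a) i') (nth 0 (0 :: a) i'.+1) (drop i' u)
  end.

(* psi_a; meaningful when size w <= size a. *)
Definition elevator (a w : seq nat) : seq nat := elevator_step a w (size w).

(* [scanl] computes R'_i = elevator R'_{i-1} R_i from R'_1 = R_1. *)
Definition elevator_filling (F : seq (seq nat)) : seq (seq nat) :=
  if F is R1 :: Rs then R1 :: scanl elevator R1 Rs else [::].

Definition is_partition (mu : seq nat) : bool := sorted geq mu && (0 \notin mu).

Definition is_filling (mu : seq nat) (F : seq (seq nat)) : bool :=
  (shape F == mu) && all (all (fun x => 0 < x)) F.

(* A cell is a pair (row, column), the bottom row being row 0. *)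
Definition cells (F : seq (seq nat)) : seq (nat * nat) :=
  [seq (r, c) | r <- iota 0 (size F), c <- iota 0 (size (nth [::] F r))].

Definition entry (F : seq (seq nat)) (x : nat * nat) : nat :=
  nth 0 (nth [::] F x.1) x.2.

Definition left_in_row (x y : nat * nat) : bool := (x.1 == y.1) && (x.2 < y.2).

Definition is_inv_triple (F : seq (seq nat)) (x y z : nat * nat) : bool :=
  [&& left_in_row x y, x == (z.1.+1, z.2) &
    [|| (entry F x == entry F z) && (entry F z != entry F y),
        entry F z < entry F y < entry F x,
        entry F x < entry F z < entry F y |
        entry F y < entry F x < entry F z]].

Definition is_inv_pair (F : seq (seq nat)) (x y : nat * nat) : bool :=
  [&& x.1 == 0, left_in_row x y & entry F x > entry F y].

Definition filling_inv (F : seq (seq nat)) : nat :=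
  (\sum_(x <- cells F) \sum_(y <- cells F)
     \sum_(z <- cells F | is_inv_triple F x y z) 1) +
  \sum_(x <- cells F) \sum_(y <- cells F | is_inv_pair F x y) 1.

Lemma size_fill_word i m s : size (fill_word i m s) = size m.
Proof. by elim: m s => //= -[] m IH s /=; rewrite IH. Qed.

Lemma size_basement_lift i w : size (basement_lift i w) = size w.
Proof. by rewrite size_fill_word size_map size_rev. Qed.

Lemma fill_word_spec i m s :
  count negb m = size s -> all (fun x => x != i) s ->
  map (fun x => x == i) (fill_word i m s) = m /\
  filter (fun x => x != i) (fill_word i m s) = s.
Proof.
elim: m s => [|b m IH] s /=; first by case: s.
case: b => /=.
  by rewrite add0n eqxx /= => h1 h2; have [-> ->] := IH s h1 h2.
case: s => //= x s; rewrite add1n => -[h1] /andP[hx h2].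
by rewrite hx; have [-> ->] := IH s h1 h2; rewrite (negbTE hx).
Qed.

Lemma fill_word_map i w :
  fill_word i [seq x == i | x <- w] [seq x <- w | x != i] = w.
Proof.
elim: w => //= x w IH; case: (eqVneq x i) => [->|hx] /=; by rewrite IH.
Qed.

Lemma basement_lift_spec i w :
  map (fun x => x == i) (basement_lift i w) = [seq x == i | x <- rev w] /\
  filter (fun x => x != i) (basement_lift i w) = [seq x <- w | x != i].
Proof.
apply: fill_word_spec; last exact: filter_all.
by rewrite count_map count_rev size_filter.
Qed.

Lemma basement_lift_eqE i w :
  [seq x == i | x <- basement_lift i w] = rev [seq x == i | x <- w].
Proof. by have [-> _] := basement_lift_spec i w; rewrite map_rev. Qed.

Lemma basement_lift_neqE i w :
  [seq x <- basement_lift i w | x != i] = [seq x <- w | x != i].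
Proof. by have [_] := basement_lift_spec i w. Qed.

Lemma basement_liftK i : involutive (basement_lift i).
Proof.
move=> w; rewrite {1}/basement_lift map_rev basement_lift_eqE revK.
by rewrite basement_lift_neqE fill_word_map.
Qed.

Lemma lift_pathK i j : cancel (lift_path i j) (lift_path j i).
Proof.
have foldlrK s w : foldr (fun l u => basement_lift l u)
    (foldl (fun u l => basement_lift l u) w s) s = w.
  elim: s w => //= l s IH w; by rewrite IH basement_liftK.
have foldrlK s w : foldl (fun u l => basement_lift l u)
    (foldr (fun l u => basement_lift l u) w s) s = w.
  elim: s w => //= l s IH w; by rewrite basement_liftK IH.
move=> w; rewrite /lift_path; case: (ltngtP i j) => // ->.
by rewrite subnn.
Qed.

Lemma size_lift_path i j w : size (lift_path i j w) = size w.
Proof.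
rewrite /lift_path; case: ifP => _.
  by elim: (iota _ _) w => //= l s IH w; rewrite IH size_basement_lift.
by elim: (iota _ _) => //= l s IH; rewrite size_basement_lift.
Qed.

Lemma size_elevator a w : size (elevator a w) = size w.
Proof.
rewrite /elevator; move: {1}(size w); elim=> //= i IH.
by rewrite size_cat size_lift_path -size_cat cat_take_drop.
Qed.

Lemma shape_elevator_filling F : shape (elevator_filling F) = shape F.
Proof.
case: F => // R Rs /=; congr cons; elim: Rs R => //= S Rs IH R.
by rewrite size_elevator IH.
Qed.

(* Main.v *)
(* For a letter z, order the letters cyclically as z+1 < z+2 < ... < 1 < ... < z.
   Cells x and y of a row, with x to the left of y and z below x, form an
   inversion triple exactly when y < x in this order.  The map B_(z+1) turns
   inversions in the order at z into inversions in the order at z+1.  Hence each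
   step of the elevator map keeps the inversions of the remaining letters, counted
   in the order at the letter of the row below, and the first of these letters then
   accounts for the inversion triples starting at its cell. *)

Require Import Defs.
From mathcomp Require Import all_boot zify.

Set Implicit Arguments.
Unset Strict Implicit.
Unset Printing Implicit Defensive.

(** * Counting related pairs in a word *)

Fixpoint pair_count (T : Type) (r : rel T) (w : seq T) : nat :=
  if w is x :: w' then count (r x) w' + pair_count r w' else 0.

Lemma eq_in_pair_count (T : eqType) (r r' : rel T) (w : seq T) :
  {in w &, r =2 r'} -> pair_count r w = pair_count r' w.
Proof.
elim: w => //= x w IH h; congr (_ + _).
  by apply: eq_in_count => y yw; apply: h; rewrite inE ?eqxx ?yw ?orbT.
by apply: IH => y z yw zw; apply: h; rewrite inE ?yw ?zw orbT.
Qed.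

Lemma pair_count_rcons (T : Type) (r : rel T) (w : seq T) (x : T) :
  pair_count r (rcons w x) = count (r^~ x) w + pair_count r w.
Proof.
elim: w => //= y w ->; rewrite -cats1 count_cat /=; lia.
Qed.

Lemma pair_count_rev (T : Type) (r : rel T) (w : seq T) :
  pair_count r (rev w) = pair_count (fun x y => r y x) w.
Proof.
by elim: w => //= x w IH; rewrite rev_cons pair_count_rcons count_rev IH.
Qed.

Lemma pair_countE (T : Type) (x0 : T) (r : rel T) (w : seq T) :
  pair_count r w =
  \sum_(0 <= i < size w) count (r (nth x0 w i)) (drop i.+1 w).
Proof.
elim: w => [|x w IH] /=; first by rewrite big_nil.
by rewrite big_nat_recl //= drop0 IH.
Qed.

(** Pairs avoiding [i] are seen in the filtered word, and pairs meeting [i] only depend on where [i]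
    stands; these are the two data that [basement_lift] prescribes. As [q] is false on two other
    letters, no pair is counted twice. *)
Lemma pair_count_split (T : eqType) (i : T) (r : rel T) (q : rel bool)
    (w : seq T) :
    (forall x y, r x y =
       (x != i) && (y != i) && r x y || q (x == i) (y == i)) ->
    ~~ q false false ->
  pair_count r w =
  pair_count r [seq x <- w | x != i] + pair_count q [seq x == i | x <- w].
Proof.
move=> h q0; elim: w => //= x w IH.
have e : count (r x) w = (x != i) * count (r x) [seq y <- w | y != i]
    + count (q (x == i)) [seq y == i | y <- w].
  elim: w {IH} => [|y w IHw] /=; first by rewrite muln0.
  rewrite IHw h; case: (x =P i) => [->|_] /=; first by lia.
  by case: (y =P i) => [->|_] /=; rewrite ?(negbTE q0) ?orbF; lia.
rewrite IH e; case: (x != i) => /=; lia.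
Qed.

(* Equivalently, y < x in the cyclic order at z. *)
Definition cyclic_gt (z x y : nat) : bool :=
  [|| (x == z) && (z != y), z < y < x, x < z < y | y < x < z].

Lemma cyclic_gt0 (x y : nat) : 0 < x -> 0 < y -> cyclic_gt 0 x y = (y < x).
Proof. rewrite /cyclic_gt; lia. Qed.

(* B_(z+1) moves the letter z+1 from the bottom of the cyclic order at z to the
   top of the cyclic order at z+1; reversing its positions exchanges the pairs
   in which it stands to the right with those in which it stands to the left. *)
Lemma pair_count_basement_lift (z : nat) (w : seq nat) :
  pair_count (cyclic_gt z.+1) (basement_lift z.+1 w) =
  pair_count (cyclic_gt z) w.
Proof.
rewrite (@pair_count_split _ z.+1 _ (fun a b => a && ~~ b)) //; last first.
  by move=> x y; rewrite /cyclic_gt; lia.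
rewrite (@pair_count_split _ z.+1 (cyclic_gt z) (fun a b => ~~ a && b)) //;
  last by move=> x y; rewrite /cyclic_gt; lia.
rewrite basement_lift_neqE basement_lift_eqE pair_count_rev; congr (_ + _).
  (* Once z+1 is removed, the cyclic orders at z and z+1 coincide. *)
  apply: eq_in_pair_count => x y; rewrite !mem_filter /cyclic_gt; lia.
by apply: eq_in_pair_count => a b _ _; rewrite andbC.
Qed.

Lemma pair_count_lift_path (i j : nat) (w : seq nat) :
  pair_count (cyclic_gt j) (lift_path i j w) = pair_count (cyclic_gt i) w.
Proof.
have up n : forall k u, pair_count (cyclic_gt (k + n)) (lift_path k (k + n) u) =
    pair_count (cyclic_gt k) u.
  rewrite /lift_path; elim: n => [|n IH] k u.
    by rewrite addn0 leqnn subnn.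
  rewrite leq_addr addKn /= -(pair_count_basement_lift k) -[RHS]IH.
  by rewrite leq_addr addKn addnS.
case: (leqP i j) => [/subnKC <- //|/ltnW /subnKC <-].
(* A downward path is undone by the upward one, to which [up] applies. *)
by rewrite -(up (i - j) j) lift_pathK.
Qed.

(** * The elevator map on one row *)

Lemma perm_basement_lift (i : nat) (w : seq nat) :
  perm_eq (basement_lift i w) w.
Proof.
apply/permP => p.
have cE u : count p u = p i * count id [seq x == i | x <- u] +
    count p [seq x <- u | x != i].
  by elim: u => [|x u /= ->] //=; [rewrite muln0 | case: eqP => [->|_] /=; lia].
by rewrite cE [RHS]cE basement_lift_eqE basement_lift_neqE count_rev.
Qed.

Lemma perm_lift_path (i j : nat) (w : seq nat) : perm_eq (lift_path i j w) w.
Proof.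
rewrite /lift_path; case: ifP => _.
  elim: (iota _ _) w => //= l s IH w.
  by rewrite (perm_trans (IH _)) ?perm_basement_lift.
elim: (iota _ _) => //= l s IH.
by rewrite (perm_trans (perm_basement_lift _ _)).
Qed.

Lemma size_elevator_step (a w : seq nat) (i : nat) :
  size (elevator_step a w i) = size w.
Proof.
by elim: i => //= i IH; rewrite size_cat size_lift_path -size_cat cat_take_drop.
Qed.

(** For a row [u] lying on a row [a] at least as long, this is the number of inversion triples with
    x and y in [u]. *)
Definition row_inv (a u : seq nat) : nat :=
  \sum_(0 <= j < size u)
    count (cyclic_gt (nth 0 a j) (nth 0 u j)) (drop j.+1 u).

(** Loop invariant: the first [i] letters are final and already counted against the letters of [a]
    below them; the rest is still counted in the cyclic order reached so far, which is the one at 0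
    when [i] is 0. *)
Lemma pair_count_elevator_step (a w : seq nat) (i : nat) : i <= size w ->
  pair_count (cyclic_gt 0) w =
  \sum_(0 <= j < i) count (cyclic_gt (nth 0 a j)
      (nth 0 (elevator_step a w i) j)) (drop j.+1 (elevator_step a w i)) +
  pair_count (cyclic_gt (nth 0 (0 :: a) i)) (drop i (elevator_step a w i)).
Proof.
elim: i => [|i IH] iw; first by rewrite big_nil drop0.
rewrite (IH (ltnW iw)) big_nat_recr //=.
have := size_elevator_step a w i; set u := elevator_step a w i => su.
set z := nth 0 (0 :: a) i; set v := lift_path _ _ _.
have /permP cv : perm_eq v (drop i u) := perm_lift_path _ _ _.
have st : size (take i u) = i by rewrite size_takel // su ltnW.
rewrite -addnA; congr (_ + _).
  (* The step only permutes the suffix, so the counts at the placed letters do not change. *)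
  apply: eq_big_nat => j /andP[_ ji].
  rewrite nth_cat st ji nth_take // drop_cat st.
  case: ltnP => [ji'|ij]; last first.
    have -> : j.+1 = i by lia.
    by rewrite subnn drop0 cv.
  have -> : drop j.+1 u = drop j.+1 (take i u) ++ drop i u.
    by rewrite -[in LHS](cat_take_drop i u) drop_cat st ji'.
  by rewrite !count_cat cv.
(* The head of [v] is now final: its pairs give the new summand, and the tail of [v] is the new
   suffix. *)
rewrite -(pair_count_lift_path z (nth 0 a i)) -/v.
have sv : 0 < size v by rewrite size_lift_path size_drop su subn_gt0.
rewrite nth_cat !drop_cat st ltnn ltnNge leqnSn /= subnn subSnn.
by case: v sv {cv} => //= x v _; rewrite drop0.
Qed.

Lemma row_inv_elevator (a w : seq nat) :
  row_inv a (elevator a w) = pair_count (cyclic_gt 0) w.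
Proof.
rewrite (@pair_count_elevator_step a w (size w)) // drop_oversize ?addn0.
  by rewrite /row_inv size_elevator.
by rewrite size_elevator_step.
Qed.

(** * Inversions of words and fillings as sums over rows *)

Lemma count_drop_nth (p : pred nat) (u : seq nat) (k : nat) :
  count p (drop k u) = \sum_(0 <= d < size u | k <= d) p (nth 0 u d).
Proof.
elim: u k => [|x u IH] k; first by rewrite big_nil.
rewrite big_mkcond big_nat_recl // -big_mkcond /=.
by case: k => [|k] /=; rewrite ?IH // -(IH 0) drop0.
Qed.

Lemma word_invE (w : seq nat) : word_inv w = pair_count (fun x y => y < x) w.
Proof.
rewrite (pair_countE 0) big_mkord /word_inv -sum1dep_card.
rewrite -(pair_big_dep xpredT (fun i j : 'I_(size w) =>
  (i < j) && (nth 0 w j < nth 0 w i)) (fun _ _ => 1)) /=.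
apply: eq_bigr => i _; rewrite count_drop_nth big_mkord big_mkcondr.
by apply: eq_bigr => j _; case: ltnP.
Qed.

Lemma uniq_cells (F : seq (seq nat)) : uniq (cells F).
Proof.
apply: allpairs_uniq_dep => [|r _|]; rewrite ?iota_uniq //.
by move=> [? ?] [? ?] _ _ [-> ->].
Qed.

Lemma mem_cells (F : seq (seq nat)) (r c : nat) :
  ((r, c) \in cells F) = (r < size F) && (c < size (nth [::] F r)).
Proof.
apply/allpairsPdep/idP => [[r' [c' []]]|/andP[hr hc]].
  by rewrite !mem_iota !add0n => ? ? [-> ->]; apply/andP.
by exists r, c; rewrite !mem_iota.
Qed.

Lemma big_cells (F : seq (seq nat)) (P : pred (nat * nat)) (g : nat * nat -> nat) :
  \sum_(x <- cells F | P x) g x =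
  \sum_(0 <= r < size F) \sum_(0 <= c < size (nth [::] F r) | P (r, c)) g (r, c).
Proof.
rewrite big_mkcond big_allpairs_dep /index_iota subn0.
by apply: eq_bigr => r _; rewrite -big_mkcond subn0.
Qed.

Lemma sum_left_in_row (F : seq (seq nat)) (r c : nat) (p : pred nat) :
  r < size F ->
  \sum_(y <- cells F | left_in_row (r, c) y && p (entry F y)) 1 =
  count p (drop c.+1 (nth [::] F r)).
Proof.
move=> hr; rewrite big_cells (bigD1_seq r) ?mem_index_iota ?iota_uniq //=.
rewrite [X in _ + X]big1 ?addn0 => [|r' nr]; last first.
  by rewrite big1 // => d; rewrite /left_in_row /= eq_sym (negbTE nr).
rewrite count_drop_nth /left_in_row /= eqxx big_mkcondr.
by apply: eq_bigr => d _; rewrite /entry /=; case: (p _).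
Qed.

(** The cell z is determined by x, so the sum has at most one term. *)
Lemma sum_inv_triple (F : seq (seq nat)) (r c : nat) (y : nat * nat) :
  (r, c) \in cells F ->
  \sum_(z <- cells F | is_inv_triple F (r.+1, c) y z) 1 =
  left_in_row (r.+1, c) y &&
    cyclic_gt (entry F (r, c)) (entry F (r.+1, c)) (entry F y) :> nat.
Proof.
move=> rcF; set b := left_in_row _ _ && _.
rewrite (eq_bigl (fun z => (z == (r, c)) && b)) => [|[r' c']].
  by rewrite big_mkcondr -big_filter filter_pred1_uniq ?uniq_cells // big_seq1; case: b.
rewrite /b /is_inv_triple /cyclic_gt !xpair_eqE eqSS /= (eq_sym r) (eq_sym c).
case: eqP => [->|_]; last by rewrite andbF.
by case: eqP => [->|_]; rewrite ?andbF.
Qed.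

Lemma filling_invE (F : seq (seq nat)) :
    (forall r, size (nth [::] F r.+1) <= size (nth [::] F r)) ->
  filling_inv F = \sum_(0 <= r < (size F).-1)
      row_inv (nth [::] F r) (nth [::] F r.+1) + word_inv (head [::] F).
Proof.
move=> hF; have [->|F0] := eqVneq F [::].
  by rewrite /filling_inv !big_nil word_invE.
have sF : size F = (size F).-1.+1 by rewrite prednK // lt0n size_eq0.
rewrite /filling_inv; congr (_ + _); rewrite big_cells sF big_nat_recl //=.
  rewrite big1 ?add0n => [|c _]; last first.
    by rewrite big1 // => y _; rewrite big1 // => z; rewrite /is_inv_triple andbF.
  apply: eq_big_nat => r /andP[_ hr]; apply: eq_big_nat => c /andP[_ hc].
  rewrite -sum_left_in_row; last by rewrite sF ltnS.
  rewrite [RHS]big_mkcond; apply: eq_bigr => y _; rewrite sum_inv_triple.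
    by case: (_ && _).
  (* Since row lengths decrease weakly, the cell below x belongs to the diagram. *)
  by rewrite mem_cells sF ltnS ltnW // (leq_trans hc).
rewrite [X in _ + X]big1 ?addn0 => [|r _]; last first.
  by rewrite big1 // => c _; rewrite big1.
rewrite word_invE (pair_countE 0) -nth0; apply: eq_big_nat => c _.
by rewrite -sum_left_in_row // sF.
Qed.

Theorem mainTheorem3 (mu : seq nat) (F : seq (seq nat))
    (hmu : is_partition mu) (hF : is_filling mu F) :
  \sum_(R <- F) word_inv R = filling_inv (elevator_filling F).
Proof.
have /andP[smu _] := hmu; move: hF => /andP[/eqP shF posF].
have shapeF G r : size (nth [::] G r) = nth 0 (shape G) r.
  have [rG|Gr] := ltnP r (size G); first by rewrite (nth_map [::]).
  by rewrite !nth_default // size_map.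
rewrite filling_invE => [|r]; last first.
  rewrite !shapeF shape_elevator_filling shF.
  (* Absent rows have the default length 0, so the bound holds at every index. *)
  have [hr|hr] := ltnP r.+1 (size mu); last by rewrite nth_default.
  exact: (sortedP 0 smu).
case: F posF {shF} => [|R Rs] /=.
  by rewrite !big_nil word_invE.
case/andP=> _ posRs; rewrite big_cons addnC size_scanl; congr (_ + _).
rewrite (big_nth [::]); apply: eq_big_nat => r /andP[_ hr].
have -> : nth [::] (scanl elevator R Rs) r =
    elevator (nth [::] (R :: scanl elevator R Rs) r) (nth [::] Rs r).
  by rewrite nth_scanl // nth_cons_scanl 1?ltnW // (take_nth [::]) // foldl_rcons.
rewrite row_inv_elevator word_invE.
apply: eq_in_pair_count => x y xR yR.
(* Positivity makes the cyclic order at 0 the usual one; a letter 0 would be its largest element. *)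
have /allP pos := allP posRs _ (mem_nth [::] hr).
by rewrite cyclic_gt0 ?pos.
Qed.
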